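(* Let $(\lambda_n)_{n\ge 1}$ be a positive sequence with $\sum_{n=1}^\infty\lambda_n<+\infty$, and let $\Lambda_n=\sum_{k=n}^{\infty}\lambda_k$. Let $p\ne 0$ be fixed and let $(a_n)_{n\ge1}$ be a sequence with $a_n>0$ for all $n$. Let $L$ be a real number satisfying $L<p$ when $p>0$ and $L>p$ when $p<0$. When $p<0$, suppose moreover that $$\lim_{n\to\infty}\frac{\Lambda_{n+1}}{\lambda_n}\Big(\frac{\sum_{k=n+1}^{\infty}\lambda_ka_k}{\Lambda_{n+1}}\Big)^p=0 .$$ (i) If $p>1$ or $p<0$, and if for all $n\ge 1$ (with the convention $\Lambda_0/\lambda_0=1$) $$L\ \ge\ \frac{\Lambda_{n-1}}{\lambda_{n-1}}-\frac{\Lambda_n}{\lambda_n},$$ then $$\sum_{n=1}^{\infty}\Big(\sum_{k=n}^{\infty}\frac{\lambda_ka_k}{\Lambda_n}\Big)^p\ \le\ \Big(\frac{p}{p-L}\Big)^p\sum_{n=1}^{\infty}a_n^p .$$ (ii) If $0<p<1$, and if for all $n\ge 1$ (with the convention $\Lambda_0/\lambda_0=1$) $$L\ \le\ \frac{\Lambda_{n-1}}{\lambda_{n-1}}-\frac{\Lambda_n}{\lambda_n},$$ then $$\sum_{n=1}^{\infty}\Big(\sum_{k=n}^{\infty}\frac{\lambda_ka_k}{\Lambda_n}\Big)^p\ \ge\ \Big(\frac{p}{p-L}\Big)^p\sum_{n=1}^{\infty}a_n^p .$$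
   Context: The symbol $\Lambda_0/\lambda_0$ is a formal quantity set equal to $1$; it is used only in the condition for $n=1$. All sums have nonnegative terms and take values in $[0,+\infty]$, with $(+\infty)^s=+\infty$ for $s>0$ and $(+\infty)^s=0$ for $s<0$. *)

(* Defs.v *)
From mathcomp Require Import all_boot all_order all_algebra.
From mathcomp Require Import all_classical all_reals all_analysis.

Set Implicit Arguments.
Unset Strict Implicit.
Unset Printing Implicit Defensive.

Import Order.TTheory GRing.Theory Num.Theory.
Import numFieldNormedType.Exports.

Local Open Scope classical_set_scope.
Local Open Scope ring_scope.

(* Sequences indexed by n >= 1 are functions on nat whose value at 0 is
   irrelevant. *)

(* Lambda_n; [fine] is harmless when the series of the [lam k], k >= 1,
   converges and n >= 1. *)
Definition tail_sum (R : realType) (lam : nat -> R) (n : nat) : R :=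
  fine (\sum_(n <= k <oo) (lam k)%:E)%E.

(* Lambda_n / lambda_n, with the convention Lambda_0 / lambda_0 = 1. *)
Definition tail_ratio (R : realType) (lam : nat -> R) (n : nat) : R :=
  if n is 0%N then 1 else tail_sum lam n / lam n.

(* The library's [poweR] sends +oo to +oo for negative exponents as well; here
   (+oo)^s = 0 for s < 0. *)
Definition epow (R : realType) (x : \bar R) (s : R) : \bar R :=
  if (x == +oo%E) && (s < 0) then 0%E else poweR x s.

(* Main.v *)
(* Elliott's telescoping argument. Write A_n = sum_(k >= n) lam_k a_k / Lam_n,
   r_n = Lam_n / lam_n (r_0 = 1) and c = p / (p - L). Then
   a_n = r_n A_n - (r_n - 1) A_(n+1), and with the tangent-line defect
   D(x, y) = x^p - p x y^(p-1) + (p-1) y^p one has, for T_n = (r_n - 1) A_(n+1)^p,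
     (c a_n)^p - A_n^p - c (T_(n-1) - T_n)
       = D(c a_n, A_n) + c (r_n - 1) D(A_(n+1), A_n)
         + (c (p + r_n - r_(n-1)) - p) A_n^p.
   D is nonnegative for p > 1 or p < 0 and nonpositive for 0 < p < 1, and the
   hypothesis on L gives the last term the same sign. Summing over n <= N leaves
   only the boundary term c T_N: it has the right sign for 0 < p < 1, tends to 0
   by hypothesis for p < 0, and vanishes for p > 1 once the sequence a is
   truncated after rank N. *)
Require Import Defs.
From mathcomp Require Import all_boot all_order all_algebra.
From mathcomp Require Import all_classical all_reals all_analysis.
From mathcomp Require Import ring lra.
Import Order.TTheory GRing.Theory Num.Theory.
Import numFieldNormedType.Exports.
Local Open Scope classical_set_scope.
Local Open Scope ring_scope.
Set Implicit Arguments.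
Unset Strict Implicit.


(** * Tangent-line bounds for real powers and the sign of the defect *)

Lemma powR_le_tangent (R : realType) (p t : R) :
  0 < p < 1 -> 0 <= t -> t `^ p <= 1 + p * (t - 1).
Proof.
move=> /andP[p0 p1] t0.
have q0 : 0 < 1 - p by lra.
(* Young's inequality for the product of t^p and 1, with conjugate exponents 1/p and 1/(1-p), reads
   t^p <= p t + (1 - p). *)
have := @conjugate_powR R (t `^ p) 1 p^-1 (1 - p)^-1 (powR_ge0 _ _) ler01.
rewrite !invr_gt0 !invrK powR1 -powRrM mulfV ?gt_eqF// powRr1//.
move=> /(_ p0 q0); lra.
Qed.

(** For p > 1, the concave bound with exponent 1/p at w = 1 + p (t - 1) gives w^(1/p) <= t, which is
    raised to the power p; a nonpositive w is trivial. For p < 0, t^p = exp(p ln t) >= 1 + p ln t,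
    and ln t <= t - 1 is reversed by the factor p. *)
Lemma powR_ge_tangent (R : realType) (p t : R) :
  1 < p \/ p < 0 -> 0 <= t -> (p < 0 -> 0 < t) -> 1 + p * (t - 1) <= t `^ p.
Proof.
move=> [p1|p0] t0 tp.
- have [w0|w0] := leP (1 + p * (t - 1)) 0.
    exact: le_trans w0 (powR_ge0 _ _).
  have pp : 0 < p by lra.
  have ip : 0 < p^-1 < 1 by rewrite invr_gt0 pp invf_lt1.
  have := powR_le_tangent ip (ltW w0).
  rewrite (_ : 1 + _ * (1 + _ - 1) = t); last by field; lra.
  move=> /(ge0_ler_powR (ltW pp)).
  rewrite !nnegrE -powRrM mulVf ?gt_eqF// powRr1 ?(ltW w0)//.
  by apply => //; exact: powR_ge0.
- have {}tp := tp p0.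
  rewrite /powR gt_eqF//; apply: le_trans (expR_ge1Dx _).
  have := @le_ln1Dx R (t - 1).
  rewrite (_ : 1 + (t - 1) = t); last by ring.
  move=> /(_ ltac:(lra)) h.
  by rewrite lerD2l ler_nM2l.
Qed.

(* [y `^ p / y] stands for y^(p-1). *)
Definition powR_gap (R : realType) (p x y : R) : R :=
  x `^ p - p * x * (y `^ p / y) + (p - 1) * y `^ p.

(** The defect is homogeneous of degree p, so its sign reduces to the one-variable tangent bounds at
    x / y. *)
Lemma powR_gapE (R : realType) (p x y : R) : 0 <= x -> 0 < y ->
  powR_gap p x y = y `^ p * ((x / y) `^ p - (1 + p * (x / y - 1))).
Proof.
move=> x0 y0; have yN0 : y != 0 by rewrite gt_eqF.
rewrite mulrBr -powRM ?(ltW y0) ?divr_ge0 ?(ltW y0)//.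
rewrite /powR_gap (mulrC y) divfK//; field.
by rewrite yN0.
Qed.

Lemma powR_gap_ge0 (R : realType) (p x y : R) :
  1 < p \/ p < 0 -> 0 <= x -> (p < 0 -> 0 < x) -> 0 < y -> 0 <= powR_gap p x y.
Proof.
move=> hp x0 xp y0; rewrite powR_gapE// mulr_ge0 ?powR_ge0// subr_ge0.
by apply: powR_ge_tangent => // [|/xp ?]; rewrite ?divr_ge0 ?divr_gt0// ltW.
Qed.

Lemma powR_gap_le0 (R : realType) (p x y : R) :
  0 < p < 1 -> 0 <= x -> 0 < y -> powR_gap p x y <= 0.
Proof.
move=> hp x0 y0; rewrite powR_gapE// mulr_ge0_le0 ?powR_ge0// subr_le0.
by apply: powR_le_tangent => //; rewrite divr_ge0// ltW.
Qed.

(* [q] is the ratio r_(n-1), and [B] is A_(n+1). *)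
Lemma powR_gap_step (R : realType) (p c q r a A B : R) : 0 < A ->
  a = r * A - (r - 1) * B ->
  (c * a) `^ p - A `^ p - c * ((q - 1) * A `^ p - (r - 1) * B `^ p) =
  powR_gap p (c * a) A + c * (r - 1) * powR_gap p B A +
  (c * (p + r - q) - p) * A `^ p.
Proof.
by move=> A0 ->; rewrite /powR_gap; field; rewrite gt_eqF.
Qed.

(** * Telescoped inequalities for finite sums *)

Section finite_sums.
Context {R : realType}.
Variables (p c : R) (r a A : nat -> R) (N : nat).
Hypotheses (c_gt0 : 0 < c) (r0 : r 0%N = 1).
Hypothesis r_ge1 : forall n, (1 <= n)%N -> 1 <= r n.
Hypothesis a_gt0 : forall n, (1 <= n <= N)%N -> 0 < a n.
Hypothesis A_gt0 : forall n, (1 <= n <= N)%N -> 0 < A n.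
Hypothesis aE : forall n, (1 <= n <= N)%N ->
  a n = r n * A n - (r n - 1) * A n.+1.

Let gap n := (c * a n) `^ p - A n `^ p -
  c * ((r n.-1 - 1) * A n `^ p - (r n - 1) * A n.+1 `^ p).

Let sum_gap : \sum_(1 <= n < N.+1) gap n =
  c `^ p * (\sum_(1 <= n < N.+1) a n `^ p) - \sum_(1 <= n < N.+1) A n `^ p +
  c * ((r N - 1) * A N.+1 `^ p).
Proof.
rewrite [LHS]sumrB sumrB; congr (_ - _ + _).
  rewrite mulr_sumr; apply: eq_big_nat => n nN.
  by rewrite powRM// ?ltW// a_gt0.
rewrite -mulr_sumr -mulrN; congr (_ * _).
(* The telescoping starts from a term with factor r 0 - 1, zero by [r0]; only the term at N
   survives. *)
elim: N => [|m IH]; first by rewrite big_geq// r0 subrr mul0r oppr0.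
by rewrite big_nat_recr//= opprD IH; ring.
Qed.

(** Each [gap n] splits into three nonnegative terms. For p > 1 the value [A N.+1] may be 0, as
    happens for truncated tails. *)
Lemma sum_powR_avg_le : 1 < p \/ p < 0 -> (p < 0 -> 0 < A N.+1) ->
  0 <= A N.+1 ->
  (forall n, (1 <= n <= N)%N -> p <= c * (p + r n - r n.-1)) ->
  \sum_(1 <= n < N.+1) A n `^ p <=
    c `^ p * (\sum_(1 <= n < N.+1) a n `^ p) + c * ((r N - 1) * A N.+1 `^ p).
Proof.
move=> hp Ap A0 hr; rewrite -subr_ge0.
have -> : forall x y z : R, x + y - z = x - z + y by move=> *; ring.
rewrite -sum_gap big_nat sumr_ge0// => n /[dup] nN /andP[n1 _].
rewrite /gap (@powR_gap_step _ p c _ (r n))//; [|exact: A_gt0|exact: aE].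
(* [A_gt0] covers [A n.+1] only for n < N; the last index relies on the separate hypotheses about
   [A N.+1]. *)
have AS : 0 <= A n.+1 /\ (p < 0 -> 0 < A n.+1).
  move: nN; rewrite n1 ltnS leq_eqVlt => /predU1P[->//|nN].
  by rewrite ltW A_gt0// n1.
have ca : 0 < c * a n by rewrite mulr_gt0// a_gt0.
apply: addr_ge0; first apply: addr_ge0.
- by apply: powR_gap_ge0 => //; [exact: ltW|exact: A_gt0].
- rewrite mulr_ge0//; first by rewrite mulr_ge0 ?subr_ge0 ?r_ge1// ltW.
  by case: AS => ? ?; apply: powR_gap_ge0 => //; exact: A_gt0.
- by rewrite mulr_ge0 ?powR_ge0// subr_ge0 hr.
Qed.

Lemma sum_powR_avg_ge : 0 < p < 1 -> 0 <= A N.+1 ->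
  (forall n, (1 <= n <= N)%N -> c * (p + r n - r n.-1) <= p) ->
  c `^ p * (\sum_(1 <= n < N.+1) a n `^ p) <= \sum_(1 <= n < N.+1) A n `^ p.
Proof.
move=> hp A0 hr.
have bd : 0 <= c * ((r N - 1) * A N.+1 `^ p).
  case: (N) => [|m]; first by rewrite r0 subrr mul0r mulr0.
  by rewrite mulr_ge0 ?(ltW c_gt0)// mulr_ge0 ?powR_ge0// subr_ge0 r_ge1.
suff : \sum_(1 <= n < N.+1) gap n <= 0 by rewrite sum_gap; lra.
rewrite big_nat sumr_le0// => n /[dup] nN /andP[n1 _].
rewrite /gap (@powR_gap_step _ p c _ (r n))//; [|exact: A_gt0|exact: aE].
have AS : 0 <= A n.+1.
  move: nN; rewrite n1 ltnS leq_eqVlt => /predU1P[->//|nN].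
  by rewrite ltW// A_gt0// n1.
have ca : 0 < c * a n by rewrite mulr_gt0// a_gt0.
rewrite -oppr_ge0 2!opprD; apply: addr_ge0; first apply: addr_ge0;
  rewrite oppr_ge0.
- by apply: powR_gap_le0 => //; [exact: ltW|exact: A_gt0].
- rewrite mulr_ge0_le0//; first by rewrite mulr_ge0 ?subr_ge0 ?r_ge1// ltW.
  by apply: powR_gap_le0 => //; exact: A_gt0.
- by rewrite mulr_le0_ge0 ?powR_ge0// subr_le0 hr.
Qed.

End finite_sums.

(** * Series of nonnegative reals, their tails and limits *)

Lemma nneseries_le_bound (R : realType) (u : nat -> R) (m : nat) (C : \bar R) :
  (forall k, (m <= k)%N -> 0 <= u k) ->
  (forall N, ((\sum_(m <= k < N.+1) u k)%:E <= C)%E) ->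
  (\sum_(m <= k <oo) (u k)%:E <= C)%E.
Proof.
move=> u0 uC; apply: lime_le.
  by apply: is_cvg_nneseries => k mk _; rewrite lee_fin u0.
near=> N; rewrite sumEFin -(@prednK N); first exact: uC.
by near: N; exact: nbhs_infty_gt.
Unshelve. all: by end_near. Qed.

Lemma eq_eseries_ge (R : realType) (f g : nat -> \bar R) (m : nat) :
  (forall k, (m <= k)%N -> f k = g k) ->
  (\sum_(m <= k <oo) f k = \sum_(m <= k <oo) g k)%E.
Proof.
move=> fg; rewrite eseries_cond [RHS]eseries_cond.
by apply: eq_eseriesr => k; exact: fg.
Qed.

Lemma nneseriesZr (R : realType) (f : nat -> R) (n : nat) (d : R) :
  (forall k, (n <= k)%N -> 0 <= f k) ->
  (\sum_(n <= k <oo) (f k * d)%:E = (\sum_(n <= k <oo) (f k)%:E) * d%:E)%E.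
Proof.
move=> f0; rewrite eseries_cond [in RHS]eseries_cond muleC -nneseriesZl.
  by apply: eq_eseriesr => k _; rewrite mulrC EFinM.
by move=> k nk; rewrite lee_fin f0.
Qed.

Section tail_sum.
Context (R : realType).
Variable f : nat -> R.
Hypothesis f_gt0 : forall k, (1 <= k)%N -> 0 < f k.
Hypothesis f_sum : (\sum_(1 <= k <oo) (f k)%:E < +oo)%E.

Let fe_ge0 n k : (1 <= n)%N -> (n <= k)%N -> (0 <= (f k)%:E)%E.
Proof. by move=> n1 nk; rewrite lee_fin ltW// f_gt0// (leq_trans n1). Qed.

Lemma tail_sumE n : (1 <= n)%N ->
  (\sum_(n <= k <oo) (f k)%:E = (tail_sum f n)%:E)%E.
Proof.
move=> n1; rewrite /tail_sum fineK// ge0_fin_numE; last first.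
  by apply: nneseries_ge0 => k nk _; exact: fe_ge0 nk.
apply: le_lt_trans f_sum.
rewrite (@nneseries_split _ _ 1%N n.-1) => [|k]; last exact: fe_ge0.
rewrite add1n prednK// leeDr// big_nat sume_ge0// => k /andP[k1 _].
exact: (@fe_ge0 1).
Qed.

Lemma tail_sumS n : (1 <= n)%N -> tail_sum f n = f n + tail_sum f n.+1.
Proof.
move=> n1; apply: EFin_inj; rewrite EFinD -!tail_sumE//.
rewrite (@nneseries_split _ _ n 1%N) => [|k]; last exact: fe_ge0.
by rewrite addn1 big_nat1.
Qed.

Lemma tail_sum_gt0 n : (1 <= n)%N -> 0 < tail_sum f n.
Proof.
move=> n1; rewrite tail_sumS// ltr_wpDr ?f_gt0//.
rewrite -lee_fin -tail_sumE// nneseries_ge0// => k nk _.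
exact: fe_ge0 nk.
Qed.

Lemma sum_le_tail_sum N : \sum_(1 <= k < N.+1) f k <= tail_sum f 1.
Proof.
rewrite -lee_fin -tail_sumE// -sumEFin.
by apply: nneseries_lim_ge => k k1 _; exact: (@fe_ge0 1).
Qed.

Lemma cvg_sum_tail_sum n : (1 <= n)%N ->
  \sum_(n <= k < N.+1) f k @[N --> \oo] --> tail_sum f n.
Proof.
move=> n1.
have : (\sum_(n <= k < N) (f k)%:E @[N --> \oo] --> (tail_sum f n)%:E)%E.
  rewrite -tail_sumE//; apply: is_cvg_nneseries => k nk _; exact: fe_ge0 nk.
move=> /fine_cvgP[_]; rewrite -cvg_shiftS.
by under eq_fun do rewrite /= sumEFin/=.
Qed.

End tail_sum.

Lemma cvg_powR (R : realType) (p x : R) (u : nat -> R) : 0 < x ->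
  u n @[n --> \oo] --> x -> u n `^ p @[n --> \oo] --> x `^ p.
Proof.
move=> x0 ux.
have : {for x, continuous (fun y : R => y `^ p)}.
  apply: differentiable_continuous; apply/derivable1_diffP.
  by apply: derivable_powR; rewrite in_itv/= x0.
exact: cvg_comp ux.
Qed.

(** * Averages of weighted tails *)

Section weighted_tails.
Context (R : realType).
Variables (lam a : nat -> R) (p L : R).
Hypothesis lam_gt0 : forall n, (1 <= n)%N -> 0 < lam n.
Hypothesis lam_sum : (\sum_(1 <= n <oo) (lam n)%:E < +oo)%E.
Hypothesis p_neq0 : p != 0.
Hypothesis a_gt0 : forall n, (1 <= n)%N -> 0 < a n.
Hypothesis L_lt : 0 < p -> L < p.
Hypothesis L_gt : p < 0 -> p < L.

Local Notation Lam := (tail_sum lam).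
Local Notation c := (p / (p - L)).

Let b_gt0 n : (1 <= n)%N -> 0 < lam n * a n.
Proof. by move=> n1; rewrite mulr_gt0 ?lam_gt0 ?a_gt0. Qed.

Let Lam_gt0 n : (1 <= n)%N -> 0 < Lam n.
Proof. exact: tail_sum_gt0. Qed.

(** In both cases p and p - L have the same sign. *)
Lemma ratio_gt0 : 0 < c.
Proof.
have [/[dup] p0 /L_lt ?|/[dup] p0 /L_gt ?|p0] := ltgtP 0 p.
- by rewrite divr_gt0// subr_gt0.
- by rewrite -mulrNN -invrN divr_gt0 ?oppr_gt0 ?subr_lt0.
- by move: p_neq0; rewrite -p0 eqxx.
Qed.

Let c_gt0 := ratio_gt0.

Let cpL : c * (p - L) = p.
Proof.
(* If p - L were 0, the convention 0^-1 = 0 would make c zero. *)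
by rewrite divfK//; apply: contraTN ratio_gt0 => /eqP->; rewrite invr0 mulr0 ltxx.
Qed.

(** Identifies the coefficient of the boundary term with the factor in the limit hypothesis. *)
Lemma tail_ratioB1 n : (1 <= n)%N -> tail_ratio lam n - 1 = Lam n.+1 / lam n.
Proof.
case: n => // n _; rewrite /tail_ratio tail_sumS//.
by field; rewrite gt_eqF// lam_gt0.
Qed.

Lemma tail_ratio_ge1 n : (1 <= n)%N -> 1 <= tail_ratio lam n.
Proof.
by move=> n1; rewrite -subr_ge0 tail_ratioB1// divr_ge0// ltW ?Lam_gt0 ?lam_gt0.
Qed.

(** Only the one-step recurrence of S matters, so both full and truncated tails qualify. *)
Lemma avg_recurrence (S : nat -> R) n : (1 <= n)%N ->
  S n = lam n * a n + S n.+1 ->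
  a n = tail_ratio lam n * (S n / Lam n) -
    (tail_ratio lam n - 1) * (S n.+1 / Lam n.+1).
Proof.
move=> n1 ->; rewrite tail_ratioB1//.
rewrite (_ : tail_ratio lam n = Lam n / lam n); last by case: n n1.
field; rewrite !gt_eqF//; [exact: Lam_gt0|exact: lam_gt0|exact: Lam_gt0].
Qed.

Lemma epow_avg n : (1 <= n)%N ->
  epow (\sum_(n <= k <oo) (lam k * a k / Lam n)%:E)%E p =
  epow ((\sum_(n <= k <oo) (lam k * a k)%:E) * ((Lam n)^-1)%:E)%E p.
Proof.
move=> n1; congr epow.
rewrite (@nneseriesZr _ (fun k => lam k * a k))// => k nk.
by rewrite ltW// b_gt0// (leq_trans n1).
Qed.

Lemma epow_fin_avg n : (\sum_(1 <= n <oo) (lam n * a n)%:E < +oo)%E ->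
  (1 <= n)%N ->
  epow ((\sum_(n <= k <oo) (lam k * a k)%:E) * ((Lam n)^-1)%:E)%E p =
  ((tail_sum (fun k => lam k * a k) n / Lam n) `^ p)%:E.
Proof. by move=> S_fin n1; rewrite tail_sumE. Qed.

(** Removing finitely many finite terms from a divergent sum leaves it infinite, so every average is
    +oo. *)
Lemma epow_infty_avg n : (\sum_(1 <= n <oo) (lam n * a n)%:E = +oo)%E ->
  (1 <= n)%N ->
  epow ((\sum_(n <= k <oo) (lam k * a k)%:E) * ((Lam n)^-1)%:E)%E p =
  if p < 0 then 0%E else +oo%E.
Proof.
move=> S_infty n1.
have -> : (\sum_(n <= k <oo) (lam k * a k)%:E = +oo)%E.
  move: S_infty; rewrite (@nneseries_split _ _ 1%N n.-1) => [|k k1]; last first.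
    by rewrite lee_fin ltW// b_gt0.
  rewrite add1n prednK// sumEFin.
  by case: (\sum_(n <= k <oo) _)%E.
rewrite gt0_mulye ?lte_fin ?invr_gt0 ?Lam_gt0// /epow eqxx andTb.
by case: ifP => // _; rewrite poweRyr.
Qed.

(** S is left abstract: it will be the tail truncated at N when p > 1, and the full tail when p <
    0. *)
Lemma sum_avg_le_finite (S : nat -> R) N :
  1 < p \/ p < 0 ->
  (forall n, (1 <= n)%N -> tail_ratio lam n.-1 - tail_ratio lam n <= L) ->
  (forall n, (1 <= n <= N)%N -> S n = lam n * a n + S n.+1) ->
  (forall n, (1 <= n <= N)%N -> 0 < S n) ->
  0 <= S N.+1 -> (p < 0 -> 0 < S N.+1) ->
  \sum_(1 <= n < N.+1) (S n / Lam n) `^ p <=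
    c `^ p * (\sum_(1 <= n < N.+1) a n `^ p) +
    c * ((tail_ratio lam N - 1) * (S N.+1 / Lam N.+1) `^ p).
Proof.
move=> hp hL SE S_gt0 SN SNp.
apply: (@sum_powR_avg_le _ p c (tail_ratio lam) a (fun n => S n / Lam n)) => //.
- exact: tail_ratio_ge1.
- by move=> n /andP[n1 _]; exact: a_gt0.
- by move=> n /[dup] /andP[n1 _] nN; rewrite divr_gt0 ?S_gt0 ?Lam_gt0.
- by move=> n /[dup] /andP[n1 _] nN; apply: avg_recurrence => //; exact: SE.
- by move=> /SNp ?; rewrite divr_gt0 ?Lam_gt0.
- by rewrite divr_ge0// ltW ?Lam_gt0.
(* Writing p as c (p - L) and cancelling c > 0 turns the goal into the hypothesis on L. *)
- move=> n /andP[/hL hLn _]; rewrite -[leLHS]cpL ler_pM2l//; lra.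
Qed.

Lemma sum_avg_ge_finite (S : nat -> R) N :
  0 < p < 1 ->
  (forall n, (1 <= n)%N -> L <= tail_ratio lam n.-1 - tail_ratio lam n) ->
  (forall n, (1 <= n)%N -> S n = lam n * a n + S n.+1) ->
  (forall n, (1 <= n)%N -> 0 < S n) ->
  c `^ p * (\sum_(1 <= n < N.+1) a n `^ p) <=
  \sum_(1 <= n < N.+1) (S n / Lam n) `^ p.
Proof.
move=> hp hL SE S_gt0.
apply: (@sum_powR_avg_ge _ p c (tail_ratio lam) a (fun n => S n / Lam n)) => //.
- exact: tail_ratio_ge1.
- by move=> n /andP[n1 _]; exact: a_gt0.
- by move=> n /andP[n1 _]; rewrite divr_gt0 ?S_gt0 ?Lam_gt0.
- by move=> n /andP[n1 _]; apply: avg_recurrence => //; exact: SE.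
- by rewrite divr_ge0// ltW ?S_gt0 ?Lam_gt0.
- move=> n /andP[/hL hLn _]; rewrite -[leRHS]cpL ler_pM2l//; lra.
Qed.

Let S := tail_sum (fun k => lam k * a k).

Let SS n : (\sum_(1 <= n <oo) (lam n * a n)%:E < +oo)%E ->
  (1 <= n)%N -> S n = lam n * a n + S n.+1.
Proof. by move=> ? ?; rewrite /S tail_sumS. Qed.

Let S_gt0 n : (\sum_(1 <= n <oo) (lam n * a n)%:E < +oo)%E ->
  (1 <= n)%N -> 0 < S n.
Proof. by move=> ? ?; rewrite tail_sum_gt0. Qed.

(* a <= 1 + a^p since p > 1, hence lam_k a_k <= lam_k + Lam_1 a_k^p. *)
Lemma weighted_sum_lty : 1 < p -> (\sum_(1 <= n <oo) (a n `^ p)%:E < +oo)%E ->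
  (\sum_(1 <= n <oo) (lam n * a n)%:E < +oo)%E.
Proof.
move=> p1 ap.
have ap_gt0 n : (1 <= n)%N -> 0 < a n `^ p by move=> /a_gt0; exact: powR_gt0.
apply: (@le_lt_trans _ _ (Lam 1 + Lam 1 * tail_sum (fun n => a n `^ p) 1)%:E);
  last exact: ltry.
apply: nneseries_le_bound => [k /b_gt0/ltW//|N]; rewrite lee_fin.
apply: (@le_trans _ _ (\sum_(1 <= k < N.+1) (lam k + Lam 1 * a k `^ p))).
  rewrite big_nat [leRHS]big_nat; apply: ler_sum => k /andP[k1 _].
  have lk : lam k <= Lam 1.
    apply: le_trans (sum_le_tail_sum lam_gt0 lam_sum k).
    rewrite big_nat_recr//= lerDr big_nat sumr_ge0// => j /andP[j1 _].
    by rewrite ltW// lam_gt0.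
  have [a1|a1] := leP (a k) 1.
    apply: (@le_trans _ _ (lam k)); first by rewrite ger_pMr ?lam_gt0.
    by rewrite lerDl mulr_ge0 ?powR_ge0// ltW ?Lam_gt0.
  apply: ler_wpDl; first by rewrite ltW ?lam_gt0.
  by apply: ler_pM => //; [exact/ltW/lam_gt0|exact/ltW/a_gt0|];
    rewrite le1r_powR// ltW.
rewrite big_split/= -mulr_sumr lerD//; first exact: sum_le_tail_sum.
by rewrite ler_wpM2l ?(ltW (Lam_gt0 _))//; exact: sum_le_tail_sum.
Qed.

(** The finite inequality is applied to tails truncated at N >= M. With M fixed, letting N tend to
    infinity only requires termwise limits in a finite sum. *)
Lemma sum_avg_le_gt1 (K : R) M : 1 < p ->
  (\sum_(1 <= n <oo) (lam n * a n)%:E < +oo)%E ->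
  (forall n, (1 <= n)%N -> tail_ratio lam n.-1 - tail_ratio lam n <= L) ->
  (forall N, \sum_(1 <= n < N.+1) a n `^ p <= K) ->
  \sum_(1 <= n < M.+1) (S n / Lam n) `^ p <= c `^ p * K.
Proof.
move=> p1 S_fin hL aK.
pose T N n := \sum_(n <= k < N.+1) lam k * a k.
have cvgT : \sum_(1 <= n < M.+1) (T N n / Lam n) `^ p @[N --> \oo] -->
            \sum_(1 <= n < M.+1) (S n / Lam n) `^ p.
  rewrite big_nat; under eq_fun do rewrite big_nat.
  apply: cvg_big => [|n /andP[n1 _]]; first exact: add_continuous.
  apply: cvg_powR; first by rewrite divr_gt0 ?S_gt0 ?Lam_gt0.
  by apply: cvgMl; exact: cvg_sum_tail_sum.
apply: (cvgr_to_le cvgT); near=> N.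
have MN : (M <= N)%N by near: N; exact: nbhs_infty_ge.
have T_ge0 n : (1 <= n)%N -> 0 <= T N n.
  move=> n1; rewrite /T big_nat sumr_ge0// => k /andP[nk _].
  by rewrite ltW ?b_gt0// (leq_trans n1).
apply: (@le_trans _ _ (\sum_(1 <= n < N.+1) (T N n / Lam n) `^ p)).
  rewrite [leRHS](@big_cat_nat _ _ _ M.+1)//= lerDl sumr_ge0// => *.
  exact: powR_ge0.
have TN : T N N.+1 = 0 by rewrite /T big_geq.
have TS n : (1 <= n <= N)%N -> T N n = lam n * a n + T N n.+1.
  by move=> /andP[n1 nN]; rewrite /T big_ltn.
have := @sum_avg_le_finite (T N) N (or_introl p1) hL TS.
(* The truncated tail is empty at N.+1, so the boundary term is a multiple of 0^p = 0. *)
rewrite TN mul0r powR0// !mulr0 addr0 => h.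
apply: le_trans (h _ _ _) _ => //.
- move=> n /[dup] /andP[n1 _] nN.
  by rewrite TS// ltr_wpDr ?T_ge0// b_gt0.
- lra.
- by rewrite ler_wpM2l ?powR_ge0.
Unshelve. all: by end_near. Qed.

(** Full tails are used here: for N >= M the sum up to M is at most c^p K plus the boundary term at
    N, which tends to 0. *)
Lemma sum_avg_le_lt0 (K : R) M : p < 0 ->
  (\sum_(1 <= n <oo) (lam n * a n)%:E < +oo)%E ->
  Lam n.+1 / lam n * (S n.+1 / Lam n.+1) `^ p @[n --> \oo] --> 0 ->
  (forall n, (1 <= n)%N -> tail_ratio lam n.-1 - tail_ratio lam n <= L) ->
  (forall N, \sum_(1 <= n < N.+1) a n `^ p <= K) ->
  \sum_(1 <= n < M.+1) (S n / Lam n) `^ p <= c `^ p * K.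
Proof.
move=> p0 S_fin lim0 hL aK.
have : c `^ p * K +
    c * (Lam n.+1 / lam n * (S n.+1 / Lam n.+1) `^ p) @[n --> \oo] -->
    c `^ p * K + c * 0.
  by apply: cvgD; [exact: cvg_cst|exact: cvgMr lim0].
rewrite mulr0 addr0 => /cvgr_to_ge; apply; near=> N.
have MN : (M <= N)%N by near: N; exact: nbhs_infty_ge.
have N1 : (1 <= N)%N by near: N; exact: nbhs_infty_ge.
apply: (@le_trans _ _ (\sum_(1 <= n < N.+1) (S n / Lam n) `^ p)).
  rewrite [leRHS](@big_cat_nat _ _ _ M.+1)//= lerDl sumr_ge0// => *.
  exact: powR_ge0.
rewrite -tail_ratioB1//.
apply: le_trans (@sum_avg_le_finite S N (or_intror p0) hL _ _ _ _) _.
- by move=> n /andP[n1 _]; exact: SS.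
- by move=> n /andP[n1 _]; exact: S_gt0.
- by rewrite ltW// S_gt0.
- by move=> _; exact: S_gt0.
- by rewrite lerD2r ler_wpM2l ?powR_ge0.
Unshelve. all: by end_near. Qed.

End weighted_tails.

(** * Extended-valued sums: finite and infinite cases *)

Unset Implicit Arguments.
Set Strict Implicit.

Theorem corollary6p1 (R : realType) (lam a : nat -> R) (p L : R)
    (lam_gt0 : forall n : nat, (1 <= n)%N -> 0 < lam n)
    (lam_sum : (\sum_(1 <= n <oo) (lam n)%:E < +oo)%E)
    (p_neq0 : p != 0)
    (a_gt0 : forall n : nat, (1 <= n)%N -> 0 < a n)
    (L_lt : 0 < p -> L < p)
    (L_gt : p < 0 -> p < L)
    (lim0 : p < 0 ->
      ((tail_sum lam n.+1 / lam n)%:E *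
        epow ((\sum_(n.+1 <= k <oo) (lam k * a k)%:E) *
              ((tail_sum lam n.+1)^-1)%:E) p)%E @[n --> \oo] --> 0%E) :
  ((1 < p \/ p < 0) ->
    (forall n : nat, (1 <= n)%N ->
       tail_ratio lam n.-1 - tail_ratio lam n <= L) ->
    (\sum_(1 <= n <oo)
        epow (\sum_(n <= k <oo) (lam k * a k / tail_sum lam n)%:E) p
     <= ((p / (p - L)) `^ p)%:E * \sum_(1 <= n <oo) (a n `^ p)%:E)%E)
  /\
  (0 < p < 1 ->
    (forall n : nat, (1 <= n)%N ->
       L <= tail_ratio lam n.-1 - tail_ratio lam n) ->
    (((p / (p - L)) `^ p)%:E * \sum_(1 <= n <oo) (a n `^ p)%:E
     <= \sum_(1 <= n <oo)
        epow (\sum_(n <= k <oo) (lam k * a k / tail_sum lam n)%:E) p)%E).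
Proof.
have ap_gt0 n : (1 <= n)%N -> 0 < a n `^ p by move=> /a_gt0; exact: powR_gt0.
have c_gt0 : 0 < p / (p - L) by exact: ratio_gt0.
have b_gt0 n : (1 <= n)%N -> 0 < lam n * a n.
  by move=> n1; rewrite mulr_gt0 ?lam_gt0 ?a_gt0.
have cp_gt0 : 0 < (p / (p - L)) `^ p by exact: powR_gt0.
have ap_ge0 : (0 <= \sum_(1 <= n <oo) (a n `^ p)%:E)%E.
  by apply: nneseries_ge0 => n n1 _; rewrite lee_fin powR_ge0.
have avgE : (\sum_(1 <= n <oo)
      epow (\sum_(n <= k <oo) (lam k * a k / tail_sum lam n)%:E) p =
    \sum_(1 <= n <oo) epow ((\sum_(n <= k <oo) (lam k * a k)%:E) *
      ((tail_sum lam n)^-1)%:E) p)%E.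
  by apply: eq_eseries_ge => n n1; rewrite epow_avg.
have avg_finE : (\sum_(1 <= n <oo) (lam n * a n)%:E < +oo)%E ->
    (\sum_(1 <= n <oo) epow ((\sum_(n <= k <oo) (lam k * a k)%:E) *
      ((tail_sum lam n)^-1)%:E) p = \sum_(1 <= n <oo)
      ((tail_sum (fun k => lam k * a k) n / tail_sum lam n) `^ p)%:E)%E.
  by move=> S_fin; apply: eq_eseries_ge => n n1; rewrite epow_fin_avg.
have Sy : (\sum_(1 <= n <oo) (lam n * a n)%:E < +oo)%E \/
          (\sum_(1 <= n <oo) (lam n * a n)%:E = +oo)%E.
  by rewrite ltey; case: eqP; [right|left].
rewrite avgE; split=> [hp hL|/andP[p0 p1] hL].
- have [apy|] := eqVneq (\sum_(1 <= n <oo) (a n `^ p)%:E)%E +oo%E.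
    by rewrite apy gt0_muley ?lte_fin// leey.
  rewrite -ltey => ap_fin.
  have aK := sum_le_tail_sum ap_gt0 ap_fin.
  rewrite (@tail_sumE _ (fun n => a n `^ p))//.
  case: Sy => [S_fin|S_infty].
    rewrite avg_finE// -EFinM; apply: nneseries_le_bound => [*|M].
      exact: powR_ge0.
    rewrite lee_fin; case: hp => [p1|p0]; first exact: sum_avg_le_gt1.
    apply: sum_avg_le_lt0 => //.
    (* All tails are finite here, so the extended-real limit descends to a real one. *)
    have := lim0 p0.
    under eq_fun do rewrite epow_fin_avg//.
    by move=> /fine_cvgP[].
  (* With an infinite weighted sum, p > 1 contradicts [weighted_sum_lty]; for p < 0 every average is
     +oo, with power 0. *)
  case: hp => [p1|p0].
    by have := weighted_sum_lty lam_gt0 lam_sum a_gt0 p1 ap_fin; rewrite S_infty ltxx.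
  rewrite eseries0 => [|n n1 _].
    by rewrite -tail_sumE// mule_ge0// lee_fin ltW.
  by rewrite epow_infty_avg// p0.
- rewrite -lee_pdivlMl//; apply: nneseries_le_bound => [*|N].
    exact: powR_ge0.
  rewrite lee_pdivlMl// -EFinM.
  case: Sy => [S_fin|S_infty].
    rewrite avg_finE//.
    have S_gt0 n : (1 <= n)%N -> 0 < tail_sum (fun k => lam k * a k) n.
      by move=> n1; exact: tail_sum_gt0.
    have := @sum_avg_ge_finite _ lam a p L lam_gt0 lam_sum p_neq0 a_gt0 L_lt L_gt
      (tail_sum (fun k => lam k * a k)) N.
    rewrite p0 p1 => /(_ isT hL _ S_gt0) h.
    apply: (@le_trans _ _ (\sum_(1 <= n < N.+1)
      (tail_sum (fun k => lam k * a k) n / tail_sum lam n) `^ p)%:E).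
      by rewrite lee_fin h// => n n1; rewrite [LHS]tail_sumS.
    rewrite -sumEFin; apply: nneseries_lim_ge => *.
    by rewrite lee_fin powR_ge0.
  (* Every average is +oo and p > 0, so the single term n = 1 already makes the sum of powers
     infinite. *)
  apply: le_trans (leey _) _.
  rewrite (@eq_eseries_ge _ _ (fun=> +oo%E)) => [|n n1]; last first.
    by rewrite epow_infty_avg// ltNge ltW.
  have := @nneseries_lim_ge R (fun=> +oo%E) xpredT 1 2.
  by rewrite big_nat1; apply.
Qed.
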